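(* For every odd integer $n\ge 5$, $\kappa(B_n;K_{1,1})=\kappa^s(B_n;K_{1,1})=n-1$; and for every even integer $n\ge 4$, $\kappa(B_n;K_{1,1})=\kappa^s(B_n;K_{1,1})=n$.
   Context: All graphs are finite and simple. $K_{1,1}$ is the star with one leaf, i.e. a single edge with its two endpoints. Structure connectivity. For a set $\mathcal{F}$ of subgraphs of a connected graph $G$ (no disjointness is required), let $V(\mathcal{F})$ be the union of the vertex sets of its members and $G-\mathcal{F}=G-V(\mathcal{F})$. $\mathcal{F}$ is a subgraph cut of $G$ if $G-\mathcal{F}$ is disconnected or is a trivial graph (a single vertex). For a connected graph $H$, an $H$-structure cut (resp. $H$-substructure cut) is a subgraph cut each of whose members is isomorphic to $H$ (resp. to a connected subgraph of $H$). $\kappa(G;H)$ (resp. $\kappa^s(G;H)$) is the minimum cardinality of an $H$-structure cut (resp. $H$-substructure cut) of $G$. Crossed cube. Two binary strings $x_1x_0$, $y_1y_0$ are pair related, $x_1x_0\sim y_1y_0$, iff $(x_1x_0,y_1y_0)\in\{(00,00),(10,10),(01,11),(11,01)\}$. $CQ_1=K_2$ with vertices $0,1$. For $n\ge 2$, $CQ_n$ consists of two copies $CQ_{n-1}^0,CQ_{n-1}^1$ of $CQ_{n-1}$ (labels prefixed by $0$ and $1$ respectively), together with an edge between $u=0u_{n-2}\cdots u_0$ and $v=1v_{n-2}\cdots v_0$ iff $u_{n-2}=v_{n-2}$ when $n$ is even, and $u_{2i+1}u_{2i}\sim v_{2i+1}v_{2i}$ for all $0\le i<\lfloor\frac{n-1}{2}\rfloor$.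 BCDC network. $B_2$ is the $4$-cycle with vertices $[00,01],[00,10],[01,11],[10,11]$ (two of these being adjacent iff they share an entry). For $n\ge 3$, $B_{n-1}^0$ (resp. $B_{n-1}^1$) is the copy of $B_{n-1}$ obtained by prefixing both entries of each vertex $[x,y]$ with $0$ (resp. $1$), and $B_n$ consists of $B_{n-1}^0$, $B_{n-1}^1$ and the independent set $S_n=\{[a,b]: a\in V(CQ_{n-1}^0), b\in V(CQ_{n-1}^1), (a,b)\in E(CQ_n)\}$, where $[a,b]\in V(B_{n-1}^0)$ is adjacent to $[c,d]\in S_n$ iff $a=c$ or $b=c$, and $[c,d]\in S_n$ is adjacent to $[e,f]\in V(B_{n-1}^1)$ iff $e=d$ or $f=d$ (there are no edges between $B_{n-1}^0$ and $B_{n-1}^1$). Equivalently, $B_n$ is the line graph of $CQ_n$. *)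

(* Defs.v *)
From mathcomp Require Import all_boot.
Set Implicit Arguments.
Unset Strict Implicit.
Unset Printing Implicit Defensive.

(** * Finite simple graphs

A graph with vertices drawn from [T] is a pair (vertex set, edge set), an edge
being the two-element set of its endpoints.  Keeping the vertex set separate
from the carrier makes graphs and their subgraphs objects of the same finite
type, so that a set of subgraphs is a [{set graph T}] and has a cardinality. *)

Definition graph (T : finType) : finType := ({set T} * {set {set T}})%type.

Notation "'V(' G )" := (fst G) (at level 8, format "'V(' G )").
Notation "'E(' G )" := (snd G) (at level 8, format "'E(' G )").

Definition simple (T : finType) (G : graph T) : Prop :=
  forall e, e \in E(G) -> e \subset V(G) /\ #|e| = 2.

Definition adj (T : finType) (G : graph T) : rel T :=
  fun x y => [set x; y] \in E(G).

Definition subgraph (T : finType) (K G : graph T) : Prop :=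
  [/\ simple K, V(K) \subset V(G) & E(K) \subset E(G)].

(** The empty graph is neither connected nor disconnected. *)

Definition connected (T : finType) (G : graph T) : Prop :=
  V(G) != set0 /\ {in V(G) &, forall x y, connect (adj G) x y}.

Definition disconnected (T : finType) (G : graph T) : Prop :=
  exists x y, [/\ x \in V(G), y \in V(G) & ~~ connect (adj G) x y].

Definition trivial (T : finType) (G : graph T) : Prop := #|V(G)| = 1.

Definition del_vertices (T : finType) (G : graph T) (W : {set T}) : graph T :=
  (V(G) :\: W, [set e in E(G) | e \subset V(G) :\: W]).

Definition image_graph (T U : finType) (f : T -> U) (G : graph T) : graph U :=
  (f @: V(G), [set f @: (e : {set T}) | e in E(G)]).

Definition isomorphic (T U : finType) (G : graph T) (K : graph U) : Prop :=
  exists2 f : T -> U, {in V(G) &, injective f} & K = image_graph f G.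

(** * Structure connectivity *)

Definition subgraph_cut (T : finType) (G : graph T) (F : {set graph T}) : Prop :=
  (forall K, K \in F -> subgraph K G) /\
  let G' := del_vertices G (\bigcup_(K in F) V(K)) in
  disconnected G' \/ trivial G'.

Definition structure_cut (T U : finType) (G : graph T) (H : graph U)
    (F : {set graph T}) : Prop :=
  subgraph_cut G F /\ forall K, K \in F -> isomorphic H K.

Definition substructure_cut (T U : finType) (G : graph T) (H : graph U)
    (F : {set graph T}) : Prop :=
  subgraph_cut G F /\
  forall K, K \in F ->
    exists H' : graph U, [/\ subgraph H' H, connected H' & isomorphic H' K].

Definition min_card (T : finType) (P : {set T} -> Prop) (k : nat) : Prop :=
  (exists2 F, P F & #|F| = k) /\ forall F, P F -> k <= #|F|.

(** [kappa G H k] and [kappa_s G H k] read "kappa(G; H) = k" and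
"kappa^s(G; H) = k".  They are relations because, for arbitrary [G] and [H],
there may be no cut over which to minimise. *)

Definition kappa (T U : finType) (G : graph T) (H : graph U) (k : nat) : Prop :=
  min_card (structure_cut G H) k.

Definition kappa_s (T U : finType) (G : graph T) (H : graph U) (k : nat) : Prop :=
  min_card (substructure_cut G H) k.

(** The star $K_{1,r}$, with centre [ord0]. *)
Definition star (r : nat) : graph 'I_r.+1 :=
  ([set: 'I_r.+1], [set [set ord0; lift ord0 i] | i : 'I_r]).

(** * Crossed cubes *)

(** A label $u_{n-1} \dots u_0$ is the tuple of its bits as written, leading
bit first, so that $u_i$ is the [i]-th item from the end. *)

Definition label (n : nat) : finType := n.-tuple bool.

Definition prefix (n : nat) (b : bool) (u : label n) : label n.+1 :=
  [tuple of b :: u].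

Definition bit (n : nat) (u : label n) (i : nat) : bool := nth false (rev u) i.

Definition pair_related (p q : bool * bool) : bool :=
  (p, q) \in [:: ((false, false), (false, false));
                 ((true,  false), (true,  false));
                 ((false, true),  (true,  true));
                 ((true,  true),  (false, true))].

(** The condition for an edge of $CQ_n$ between $u = 0u_{n-2} \dots u_0$ and
$v = 1v_{n-2} \dots v_0$. *)
Definition cross (n : nat) (u v : label n) : bool :=
  (~~ odd n ==> (bit u n.-2 == bit v n.-2)) &&
  [forall i : 'I_(n.-1)./2,
     pair_related (bit u i.*2.+1, bit u i.*2) (bit v i.*2.+1, bit v i.*2)].

Definition CQ1 : graph (label 1) :=
  ([set: label 1], [set [set [tuple false]; [tuple true]]]).

Definition CQ_step (m : nat) (G : graph (label m)) : graph (label m.+1) :=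
  let G0 := image_graph (@prefix m false) G in
  let G1 := image_graph (@prefix m true) G in
  (V(G0) :|: V(G1),
   E(G0) :|: E(G1) :|:
   [set [set u; v] | u in V(G0), v in V(G1) & cross u v]).

(** [CQ 0] is a dummy value. *)
Fixpoint CQ (n : nat) : graph (label n) :=
  match n with
  | 0 => (set0, set0)
  | m.+1 =>
      match m return graph (label m) -> graph (label m.+1) with
      | 0 => fun _ => CQ1
      | _ => @CQ_step _
      end (CQ m)
  end.

(** * BCDC networks *)

(** The vertex $[x, y]$ is the ordered pair [(x, y)]: all vertices are written
with the lexicographically smaller label first. *)

Definition blabel (n : nat) : finType := (label n * label n)%type.

Definition bprefix (n : nat) (b : bool) (p : blabel n) : blabel n.+1 :=
  (prefix b p.1, prefix b p.2).

Definition share_entry (n : nat) (p q : blabel n) : bool :=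
  [|| p.1 == q.1, p.1 == q.2, p.2 == q.1 | p.2 == q.2].

Definition B2_vertices : {set blabel 2} :=
  [set ([tuple false; false], [tuple false; true]);
       ([tuple false; false], [tuple true; false]);
       ([tuple false; true],  [tuple true; true]);
       ([tuple true; false],  [tuple true; true])].

Definition B2 : graph (blabel 2) :=
  (B2_vertices,
   [set [set p; q] | p in B2_vertices, q in B2_vertices
                   & (p != q) && share_entry p q]).

(** The independent set $S_n$ for $n = m + 1$. *)
Definition BS (m : nat) : {set blabel m.+1} :=
  [set (a, b) | a in [set prefix false x | x in V(CQ m)],
                b in [set prefix true y | y in V(CQ m)]
              & [set a; b] \in E(CQ m.+1)].

Definition B_step (m : nat) (G : graph (blabel m)) : graph (blabel m.+1) :=
  let G0 := image_graph (@bprefix m false) G in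
  let G1 := image_graph (@bprefix m true) G in
  let S := BS m in
  (V(G0) :|: V(G1) :|: S,
   E(G0) :|: E(G1)
   :|: [set [set p; s] | p in V(G0), s in S & (p.1 == s.1) || (p.2 == s.1)]
   :|: [set [set s; q] | s in S, q in V(G1) & (q.1 == s.2) || (q.2 == s.2)]).

(** [B 0] and [B 1] are dummy values. *)
Fixpoint B (n : nat) : graph (blabel n) :=
  match n with
  | 0 => (set0, set0)
  | m.+1 =>
      match m return graph (blabel m) -> graph (blabel m.+1) with
      | 0 => fun _ => (set0, set0)
      | 1 => fun _ => B2
      | _ => @B_step _
      end (B m)
  end.

(* Main.v *)
Require Import Defs.
From mathcomp Require Import all_boot zify.
Import Defs.
Set Implicit Arguments.
Unset Strict Implicit.
Unset Printing Implicit Defensive.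

(** In both parities the value is [n./2.*2], the largest even number up to [n],
and the proof treats them together.

[B n] is the line graph of the crossed cube [CQ n]: its vertices are the edges
of [CQ n], written with the smaller label first ([arcs]), and two of them are
adjacent iff they share an endpoint ([V_B], [E_B]).  All that matters about
[CQ n] is that it joins two copies of [CQ n.-1] by a perfect matching, the graph
of an involution ([cross_twist]).  By induction this makes it [n]-regular and
triangle-free, and bounds the size of edge boundaries from below.

A member of a substructure cut covers at most two vertices of [B n], adjacent
ones if there are two ([line_clique]).

Lower bound.  If what remains of [B n] is disconnected, the endpoints reachable
from one remaining edge form a set [X] of vertices of the cube all of whose
boundary edges are covered ([disconnected_boundary]), and both [X] and its
complement contain the two endpoints of a remaining edge.
- If [X] and its complement have at least three elements, the boundary has at
  least [3 * n - 5 >= 2 * n - 1] edges ([edge_isoperimetry]); each member covers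
  at most two of them, so there are at least [n] members.
- If [X] or its complement is the pair of endpoints of a remaining edge [p], all
  neighbours of [p] are covered.  There are [n.-1] of them at each end of [p],
  and as the cube has no triangle, no member meets both ends
  ([sides_unshared]).  So each end needs [uphalf n.-1] members of its own
  ([isolation_cost]).  The rounding up is what separates the two parities.
A cut leaving a single vertex also covers all neighbours of that vertex.

Upper bound.  Cover the neighbours of any [p] at each of its ends by
[uphalf n.-1] pairs ([pair_cover]); this isolates [p], and some edge of the cube
is far enough from [p] to survive ([far_arc]). *)

(** * The matching between the two halves of a crossed cube *)

(** The pair relation keeps the low bit of a pair and adds it to the high bit, so
the edge of the crossed cube leaving [0u] across the leading dimension ends in
[1(twist u)]. *)
Definition twist (n : nat) (u : label n) : label n :=
  [tuple of rev (mkseq (fun j => bit u j (+) (odd j && bit u j.-1)) n)].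

Lemma bit_twist n (u : label n) j :
  j < n -> bit (twist u) j = bit u j (+) (odd j && bit u j.-1).
Proof. by move=> ltjn; rewrite /bit revK nth_mkseq. Qed.

Lemma eq_label n (u v : label n) :
  (forall j, j < n -> bit u j = bit v j) -> u = v.
Proof.
move=> eq_uv; apply/val_inj/(can_inj revK)/(@eq_from_nth _ false).
  by rewrite !size_rev !size_tuple.
by move=> j; rewrite size_rev size_tuple => /eq_uv.
Qed.

Lemma twistK n : involutive (@twist n).
Proof.
move=> u; apply: eq_label => j ltjn.
rewrite bit_twist // [bit _ j]bit_twist //.
case: j ltjn => [|j] ltjn /=; first by rewrite !addbF.
rewrite bit_twist; last exact: ltnW.
by case: (odd j) => /=; rewrite ?addbF // -addbA addbb addbF.
Qed.

Lemma bit_prefix n b (u : label n) j : j < n -> bit (prefix b u) j = bit u j.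
Proof. by move=> ltjn; rewrite /bit rev_cons nth_rcons size_rev size_tuple ltjn. Qed.

Lemma pair_relatedE a b c d :
  pair_related (a, b) (c, d) = (c == a (+) b) && (d == b).
Proof. by case: a b c d => [] [] [] []. Qed.

(** The parity condition in [cross] governs the one bit that is in no pair: it has
an even index, so [twist] fixes it. *)
Lemma cross_twist n a b (u v : label n) :
  cross (prefix a u) (prefix b v) = (v == twist u).
Proof.
apply/andP/eqP => [[/implyP top /forallP pairs]|->].
  have pair i : i < n./2 ->
      bit v i.*2.+1 = bit u i.*2.+1 (+) bit u i.*2 /\ bit v i.*2 = bit u i.*2.
    move=> lti; have := pairs (Ordinal lti); rewrite pair_relatedE /=.
    by rewrite !bit_prefix; try lia; case/andP=> /eqP-> /eqP->.
  apply: eq_label => j ltjn; rewrite bit_twist //.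
  have [ltj|gej] := ltnP j./2 n./2.
    have [bit_odd bit_even] := pair _ ltj.
    case: (odd j) (odd_double_half j) => /=; rewrite ?add0n ?add1n => jE.
      by move: bit_odd; rewrite jE => ->; congr (_ (+) bit u _); rewrite -[in RHS]jE.
    by move: bit_even; rewrite jE addbF.
  have [oddn jE] : odd n /\ j = n.-1 by lia.
  have := top; rewrite /= oddn jE /= => /(_ isT).
  have -> : odd n.-1 = false by lia.
  by rewrite addbF !bit_prefix; try lia; move/eqP.
split.
  apply/implyP=> /= odd_n; have even_n1 : odd n.-1 = false by lia.
  have ltn : n.-1 < n by lia.
  by rewrite !bit_prefix // bit_twist // even_n1 addbF.
apply/forallP=> -[i /= lti]; rewrite pair_relatedE !bit_prefix ?bit_twist; try lia.
by rewrite /= odd_double /= addbF !eqxx.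
Qed.

(** The edges of the crossed cube, each in the direction in which the BCDC network
names it: the end with the smaller label first.  Unlike [CQ], it starts from one
vertex in dimension 0, where inductions are vacuous. *)
Fixpoint oedge (n : nat) : label n -> label n -> bool :=
  match n return label n -> label n -> bool with
  | 0 => fun _ _ => false
  | m.+1 => fun x y =>
      if thead x == thead y then oedge (behead_tuple x) (behead_tuple y)
      else [&& ~~ thead x, thead y & behead_tuple y == twist (behead_tuple x)]
  end.

Definition cadj (n : nat) : rel (label n) := fun x y => oedge x y || oedge y x.

Lemma prefixP n (x : label n.+1) : {b & {u : label n | x = prefix b u}}.
Proof. by case/tupleP: x => b u; exists b, u. Qed.

Lemma prefix_inj n a b (u v : label n) :
  (prefix a u == prefix b v) = (a == b) && (u == v).
Proof. by rewrite -val_eqE /= eqseq_cons. Qed.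

Lemma oedge_prefix n a b (u v : label n) :
  oedge (prefix a u) (prefix b v) =
  if a == b then oedge u v else [&& ~~ a, b & v == twist u].
Proof.
have hE c (w : label n) : behead_tuple (prefix c w) = w by apply: val_inj.
by rewrite [LHS]/= !theadE !hE.
Qed.

Arguments oedge : simpl never.

Lemma cadj_prefix n a b (u v : label n) :
  cadj (prefix a u) (prefix b v) = if a == b then cadj u v else v == twist u.
Proof.
rewrite /cadj !oedge_prefix.
have tw : (u == twist v) = (v == twist u).
  by rewrite eq_sym (inv_eq (@twistK n)).
by case: a b => [] [] //=; rewrite ?orbF // tw.
Qed.

Lemma cadjC n : symmetric (@cadj n).
Proof. by move=> x y; rewrite /cadj orbC. Qed.

Lemma oedge_asym n (x y : label n) : oedge x y -> ~~ oedge y x.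
Proof.
elim: n x y => [|n IHn] x y //.
have [a [u ->]] := prefixP x; have [b [v ->]] := prefixP y.
by rewrite !oedge_prefix; case: a b => [] [] //=; apply: IHn.
Qed.

Lemma oedge_irr n (x : label n) : oedge x x = false.
Proof. by apply/negP => xx; have := oedge_asym xx; rewrite xx. Qed.

Lemma cadj_irr n (x : label n) : cadj x x = false.
Proof. by rewrite /cadj oedge_irr. Qed.

(** Of three vertices not all in the same half, two are in one half and the third
is matched to only one of them. *)
Lemma cadj_triangle_free n (x y z : label n) :
  cadj x y -> cadj y z -> cadj x z = false.
Proof.
elim: n x y z => [|n IHn] x y z //.
have [a [u ->]] := prefixP x; have [b [v ->]] := prefixP y.
have [c [w ->]] := prefixP z.
rewrite !cadj_prefix; have tinj := inv_inj (@twistK n).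
case: a b c => [] [] [] //=; do ?[exact: IHn];
  do 1?[by move=> uv /eqP->; rewrite (inj_eq tinj); apply/eqP=> E;
           rewrite E cadj_irr in uv];
  do 1?[by move=> /eqP-> /eqP->; rewrite twistK cadj_irr];
  by move=> /eqP-> vw; apply/eqP=> E; rewrite E cadj_irr in vw.
Qed.

Lemma sum_prefix n (F : label n.+1 -> nat) :
  \sum_x F x = \sum_u F (prefix false u) + \sum_u F (prefix true u).
Proof.
have hbij : bijective (fun p : bool * label n => prefix p.1 p.2).
  exists (fun x => (thead x, behead_tuple x)) => [[b u]|x] /=.
    by congr pair; apply: val_inj.
  by have [b [u ->]] := prefixP x; apply: val_inj.
rewrite (reindex _ (onW_bij _ hbij)) /=.
by rewrite -(pair_bigA _ (fun b u => F (prefix b u))) /= big_bool addnC.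
Qed.

(** Each dimension adds one neighbour, the partner in the matching. *)
Lemma cadj_regular n (x : label n) : #|[set y | cadj x y]| = n.
Proof.
rewrite -sum1dep_card big_mkcond /=; elim: n x => [|n IHn] x.
  by rewrite big1.
have [a [u ->]] := prefixP x.
have sum_tw : \sum_(v : label n) (if v == twist u then 1 else 0) = 1.
  by rewrite -big_mkcond big_pred1_eq.
rewrite sum_prefix.
under eq_bigr => v do rewrite cadj_prefix.
under [X in _ + X]eq_bigr => v do rewrite cadj_prefix.
by case: a; rewrite sum_tw IHn ?addn1 ?add1n.
Qed.

(** * Edge boundaries in a crossed cube *)

Definition boundary n (X : {set label n}) : {set blabel n} :=
  [set p | oedge p.1 p.2 && ((p.1 \in X) != (p.2 \in X))].

Definition face n (b : bool) (X : {set label n.+1}) : {set label n} :=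
  [set u | prefix b u \in X].

Lemma card_faces n (X : {set label n.+1}) :
  #|X| = #|face false X| + #|face true X|.
Proof.
rewrite -!sum1_card big_mkcond sum_prefix.
by rewrite !(big_mkcond (fun u => u \in face _ _)) /=; congr addn;
   apply: eq_bigr => u _; rewrite inE.
Qed.

(** The matching edges that leave [X] number at least the difference in size of
its two faces. *)
Lemma card_diff_leq (T : finType) (f : T -> T) (X Y : {set T}) : injective f ->
  #|X| <= #|Y| + \sum_x ((x \in X) != (f x \in Y)) /\
  #|Y| <= #|X| + \sum_x ((x \in X) != (f x \in Y)).
Proof.
move=> inj_f.
have cX : #|X| = \sum_x (x \in X) by rewrite -sum1_card big_mkcond.
have cY : #|Y| = \sum_x (f x \in Y).
  rewrite -sum1_card big_mkcond (reindex_inj inj_f); exact: eq_bigr.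
by rewrite cX cY -!big_split; split; apply: leq_sum => x _ /=;
   case: (x \in X); case: (f x \in Y).
Qed.

Lemma boundary_faces n (X : {set label n.+1}) :
  #|boundary X| = #|boundary (face false X)| + #|boundary (face true X)|
    + \sum_u ((u \in face false X) != (twist u \in face true X)).
Proof.
have bE m (Y : {set label m}) : #|boundary Y| =
    \sum_x \sum_y (oedge x y && ((x \in Y) != (y \in Y)) : nat).
  rewrite -sum1dep_card big_mkcond pair_bigA /=; apply: eq_bigr => -[x y] _ /=.
  by case: ifP.
rewrite !bE sum_prefix; under eq_bigr do rewrite sum_prefix.
under [X in _ + X]eq_bigr do rewrite sum_prefix.
rewrite !big_split /= [X in _ + (X + _)]big1 ?add0n; last first.
  by move=> u _; rewrite big1 // => v _; rewrite oedge_prefix.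
rewrite addnAC; congr (_ + _ + _).
- by apply: eq_bigr => u _; apply: eq_bigr => v _; rewrite oedge_prefix !inE.
- by apply: eq_bigr => u _; apply: eq_bigr => v _; rewrite oedge_prefix !inE.
apply: eq_bigr => u _; rewrite (bigD1 (twist u)) //= big1 ?addn0.
  by rewrite oedge_prefix eqxx !inE.
by move=> v neq; rewrite oedge_prefix /= (negPf neq).
Qed.

(** A lower bound for the boundary of [m] vertices.  It is attained by a vertex
([n] edges), by an edge ([2 * n - 2] edges) and by their complements.  The value
[3 * n - 5] for all other sizes is chosen because the induction on [n] preserves
it: it starts at the 4-cycles of [CQ 3], with 4 boundary edges, and lies above
[2 * n - 2] as soon as [n] is at least 4. *)
Definition isoperimetric_bound n m : nat :=
  if (m == 0) || (m == 2 ^ n) then 0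
  else if (m == 1) || (m.+1 == 2 ^ n) then n
  else if (m == 2) || (m.+2 == 2 ^ n) then 2 * n - 2
  else 3 * n - 5.

Lemma isoperimetric_boundD n a b d : a <= 2 ^ n -> b <= 2 ^ n ->
  a <= b + d -> b <= a + d ->
  isoperimetric_bound n.+1 (a + b) <=
    isoperimetric_bound n a + isoperimetric_bound n b + d.
Proof.
rewrite /isoperimetric_bound expnS.
(* The thresholds of the bound overlap in small cubes, where the exact value of
   [2 ^ n] is needed. *)
have : (n = 0 /\ 2 ^ n = 1) \/ (n = 1 /\ 2 ^ n = 2) \/ (n = 2 /\ 2 ^ n = 4)
       \/ (3 <= n /\ 3 * n <= 2 ^ n + 1).
  case: n => [|[|[|n]]]; [by lia.. | right; right; right; split=> //].
  by elim: n => // n IHn; rewrite expnS; lia.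
move: (2 ^ n) => N; do ?[case: ifP => ?]; lia.
Qed.

(** Split [X] into its faces: the boundary consists of theirs and of the matching
edges with one end in [X], so [isoperimetric_boundD] is the inductive step. *)
Lemma edge_isoperimetry n (X : {set label n}) :
  isoperimetric_bound n #|X| <= #|boundary X|.
Proof.
elim: n X => [|n IHn] X.
  have := max_card (mem X); rewrite card_tuple card_bool /isoperimetric_bound expn0.
  by case: #|X| => [|[|]].
have cn (Y : {set label n}) : #|Y| <= 2 ^ n.
  by apply: leq_trans (max_card _) _; rewrite card_tuple card_bool.
have [d1 d2] := card_diff_leq (face false X) (face true X) (inv_inj (@twistK n)).
rewrite card_faces boundary_faces.
apply: leq_trans (isoperimetric_boundD (cn _) (cn _) d1 d2) _.
by rewrite leq_add2r leq_add.
Qed.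

(** * BCDC networks are line graphs of crossed cubes *)

Definition arcs n : {set blabel n} := [set p | oedge p.1 p.2].

Definition matching_arc n (u : label n) : blabel n.+1 :=
  (prefix false u, prefix true (twist u)).

Definition line_edges n : {set {set blabel n}} :=
  [set [set p; q] | p in arcs n, q in arcs n & (p != q) && share_entry p q].

Lemma CQ_stepE n : CQ n.+2 = CQ_step (CQ n.+1). Proof. by []. Qed.

Lemma B_stepE n : B n.+3 = B_step (B n.+2). Proof. by []. Qed.

Lemma V_CQ n : V(CQ n.+1) = setT.
Proof.
case: n => [|n] //; elim: n => [|n IHn].
  apply/setP=> x; have [b [u ->]] := prefixP x.
  by rewrite !inE; apply/orP; case: b; [right | left]; apply: imset_f; rewrite inE.
apply/setP=> x; have [b [u ->]] := prefixP x.
rewrite CQ_stepE !inE.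
by case: b; apply/orP; [right | left]; apply: imset_f; rewrite IHn inE.
Qed.

Lemma mem_prefixed n b (x : label n.+1) :
  prefix b x \in [set prefix b y | y in V(CQ n.+1)].
Proof. by apply: imset_f; rewrite V_CQ. Qed.

Lemma CQ_cross_edge n (u v : label n.+1) :
  ([set prefix false u; prefix true v] \in E(CQ n.+2)) = (v == twist u).
Proof.
rewrite CQ_stepE !in_setU; apply/idP/eqP => [|->].
  case/orP=> [/orP[]|].
  - case/imsetP=> e _ /setP/(_ (prefix true v)); rewrite !inE eqxx orbT.
    by case/esym/imsetP=> w _ /eqP; rewrite prefix_inj.
  - case/imsetP=> e _ /setP/(_ (prefix false u)); rewrite !inE eqxx.
    by case/esym/imsetP=> w _ /eqP; rewrite prefix_inj.
  case/imset2P=> c d /imsetP[u' _ ->]; rewrite inE => /andP[/imsetP[v' _ ->]].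
  rewrite cross_twist => /eqP-> E.
  move/setP: (E) => /(_ (prefix false u)).
  rewrite !inE !prefix_inj !eqxx /= orbF => /esym/eqP->.
  by move/setP: E => /(_ (prefix true v)); rewrite !inE !prefix_inj !eqxx /= => /esym/eqP.
apply/orP; right; apply/imset2P.
exists (prefix false u) (prefix true (twist u)) => //; first exact: mem_prefixed.
by rewrite inE [X in X && _]mem_prefixed cross_twist eqxx.
Qed.

Lemma BS_matching n : BS n.+1 = [set matching_arc u | u : label n.+1].
Proof.
apply/setP=> -[a b]; apply/imset2P/imsetP => [[x y /imsetP[u _ ->]]|[u _ [-> ->]]].
  rewrite inE => /andP[/imsetP[v _ ->]]; rewrite CQ_cross_edge => /eqP-> [-> ->].
  by exists u.
exists (prefix false u) (prefix true (twist u)) => //; first exact: mem_prefixed.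
by rewrite inE [X in X && _]mem_prefixed CQ_cross_edge eqxx.
Qed.

Lemma arcs_step n :
  arcs n.+1 = bprefix false @: arcs n :|: bprefix true @: arcs n
              :|: [set matching_arc u | u : label n].
Proof.
apply/setP=> -[x y]; have [a [u ->]] := prefixP x; have [b [v ->]] := prefixP y.
rewrite !inE oedge_prefix /=; apply/idP/idP.
  case: a b => [] [] //= => [uv|/eqP->|uv].
  - by apply/orP; left; apply/orP; right; apply/imsetP; exists (u, v); rewrite ?inE.
  - by apply/orP; right; apply/imsetP; exists u.
  by apply/orP; left; apply/orP; left; apply/imsetP; exists (u, v); rewrite ?inE.
case/orP=> [/orP[]|] /imsetP[].
- case=> u' v'; rewrite inE /= => uv /eqP; rewrite xpair_eqE !prefix_inj.
  by case/andP=> /andP[/eqP-> /eqP->] /andP[/eqP-> /eqP->].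
- case=> u' v'; rewrite inE /= => uv /eqP; rewrite xpair_eqE !prefix_inj.
  by case/andP=> /andP[/eqP-> /eqP->] /andP[/eqP-> /eqP->].
move=> u' _ /eqP; rewrite xpair_eqE !prefix_inj.
by case/andP=> /andP[/eqP-> /eqP->] /andP[/eqP-> /eqP->] /=.
Qed.

Lemma arcs2 : arcs 2 = B2_vertices.
Proof.
apply/setP=> -[x y]; rewrite !inE.
case/tupleP: x => [[]] x; case/tupleP: x => [[]] x;
case/tupleP: y => [[]] y; case/tupleP: y => [[]] y; by rewrite (tuple0 x) (tuple0 y).
Qed.

Lemma V_B n : 1 < n -> V(B n) = arcs n.
Proof.
case: n => [|[|n]] // _; elim: n => [|n IHn]; first by rewrite arcs2.
by rewrite arcs_step -BS_matching -IHn B_stepE.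
Qed.

Lemma bprefix_inj n a b (p q : blabel n) :
  (bprefix a p == bprefix b q) = (a == b) && (p == q).
Proof.
by case: p q => [x y] [z t]; rewrite /bprefix !xpair_eqE /= !prefix_inj; case: (a == b).
Qed.

Lemma share_bprefix n a b (p q : blabel n) :
  share_entry (bprefix a p) (bprefix b q) = (a == b) && share_entry p q.
Proof. by rewrite /share_entry /= !prefix_inj; case: (a == b). Qed.

Lemma share_entryC n : symmetric (@share_entry n).
Proof.
move=> p q; rewrite /share_entry !(eq_sym q.1) !(eq_sym q.2).
by congr orb; apply: orbCA.
Qed.

Lemma imset_set2 (T U : finType) (f : T -> U) x y :
  f @: [set x; y] = [set f x; f y].
Proof. by rewrite imsetU !imset_set1. Qed.

Lemma set2_eq (T : finType) (x y z t : T) :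
  [set x; y] = [set z; t] -> (x = z /\ y = t) \/ (x = t /\ y = z).
Proof.
move=> E; have [xE yE] : x \in [set z; t] /\ y \in [set z; t].
  by rewrite -E !inE !eqxx orbT.
have [zE tE] : z \in [set x; y] /\ t \in [set x; y].
  by rewrite E !inE !eqxx orbT.
move: xE yE zE tE; rewrite !inE => /orP[]/eqP-> /orP[]/eqP->; auto.
  by rewrite !orbb => _ /eqP->; auto.
by rewrite !orbb => /eqP->; auto.
Qed.

Lemma mem_line_edges n (p q : blabel n) :
  ([set p; q] \in line_edges n) =
  [&& p \in arcs n, q \in arcs n, p != q & share_entry p q].
Proof.
apply/imset2P/and4P => [[p' q' pA]|[pA qA neq sh]].
  rewrite inE => /andP[qA /andP[neq sh]] /set2_eq[[-> ->]|[-> ->]] //.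
  by rewrite eq_sym share_entryC.
by exists p q => //; rewrite inE qA neq.
Qed.

(** The two halves share no label, so an edge of the line graph between different
parts always involves a matching edge, and it touches the half of prefix
[false] by its first end only, the other half by its second end only.  Two
different matching edges share no end. *)
Lemma line_edges_step n :
  line_edges n.+1 =
    [set bprefix false @: (e : {set blabel n}) | e in line_edges n]
    :|: [set bprefix true @: (e : {set blabel n}) | e in line_edges n]
    :|: [set [set p; s] | p in bprefix false @: arcs n,
                          s in [set matching_arc u | u : label n]
                        & (p.1 == s.1) || (p.2 == s.1)]
    :|: [set [set s; q] | s in [set matching_arc u | u : label n],
                          q in bprefix true @: arcs n
                        & (q.1 == s.2) || (q.2 == s.2)].
Proof.
have bE b p q : p \in arcs n -> q \in arcs n -> (p != q) && share_entry p q ->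
    [set bprefix b p; bprefix b q] \in
      [set bprefix b @: (e : {set blabel n}) | e in line_edges n].
  move=> pA qA pq; rewrite -imset_set2; apply: imset_f.
  by apply/imset2P; exists p q => //; rewrite inE qA.
have sub b p : p \in arcs n -> bprefix b p \in arcs n.+1.
  by move=> pA; rewrite arcs_step !inE; case: b; rewrite imset_f ?orbT.
have msub u : matching_arc u \in arcs n.+1.
  by rewrite arcs_step inE imset_f ?orbT.
have cross0 p u : p \in arcs n -> (share_entry (bprefix false p) (matching_arc u)) ->
    [set bprefix false p; matching_arc u] \in
    [set [set p; s] | p in bprefix false @: arcs n,
                          s in [set matching_arc u | u : label n]
                        & (p.1 == s.1) || (p.2 == s.1)].
  move=> pA; rewrite /share_entry /= !prefix_inj /= orbF => sh.
  apply/imset2P; exists (bprefix false p) (matching_arc u) => //.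
    exact: imset_f.
  by rewrite inE imset_f //= !prefix_inj.
have cross1 p u : p \in arcs n -> (share_entry (bprefix true p) (matching_arc u)) ->
    [set matching_arc u; bprefix true p] \in
    [set [set s; q] | s in [set matching_arc u | u : label n],
                          q in bprefix true @: arcs n
                        & (q.1 == s.2) || (q.2 == s.2)].
  move=> pA; rewrite /share_entry /= !prefix_inj /= => sh.
  apply/imset2P; exists (matching_arc u) (bprefix true p) => //.
    exact: imset_f.
  by rewrite inE imset_f //= !prefix_inj.
apply/setP=> e; apply/idP/idP.
  case/imset2P=> p q pA; rewrite inE => /andP[qA /andP[neq sh]] ->.
  move: pA qA; rewrite arcs_step !in_setU -!orbA.
  case/or3P=> /imsetP[p' pA Ep]; case/or3P=> /imsetP[q' qA Eq]; subst p q;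
    move: neq sh; rewrite ?share_bprefix ?bprefix_inj //= => neq sh;
    rewrite ?bE ?neq ?orbT //.
  - by rewrite cross0 ?orbT.
  - by rewrite [[set bprefix _ _; _]]setUC cross1 ?orbT.
  - by rewrite [[set matching_arc _; _]]setUC cross0 ?orbT // share_entryC.
  - by rewrite cross1 ?orbT // share_entryC.
  move: sh neq; rewrite /share_entry /= !prefix_inj /= (inj_eq (inv_inj (@twistK n))).
  by rewrite orbb => /eqP->; rewrite eqxx.
rewrite !in_setU -!orbA => /or4P[] => [/imsetP[f]|/imsetP[f]|/imset2P[p q]|/imset2P[p q]].
- case/imset2P=> p q pA; rewrite inE => /andP[qA pq] -> ->.
  by rewrite imset_set2 mem_line_edges !sub // bprefix_inj share_bprefix eqxx.
- case/imset2P=> p q pA; rewrite inE => /andP[qA pq] -> ->.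
  by rewrite imset_set2 mem_line_edges !sub // bprefix_inj share_bprefix eqxx.
- case/imsetP=> p' pA ->; rewrite inE => /andP[/imsetP[u _ ->] sh] ->.
  rewrite mem_line_edges sub // msub xpair_eqE /= !prefix_inj andbF /=.
  by rewrite /share_entry; case/orP: sh => ->; rewrite ?orbT.
case/imsetP=> u _ ->; rewrite inE => /andP[/imsetP[p' pA ->] sh] ->.
rewrite mem_line_edges sub // msub xpair_eqE /= ?prefix_inj /=.
by rewrite share_entryC /share_entry; case/orP: sh => ->; rewrite ?orbT.
Qed.

Lemma E_B n : 1 < n -> E(B n) = line_edges n.
Proof.
case: n => [|[|n]] // _; elim: n => [|n IHn]; first by rewrite /line_edges arcs2.
by rewrite line_edges_step -BS_matching -(@V_B n.+2) // -IHn B_stepE.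
Qed.

(** * Edges of the cube around a vertex and around an edge *)

Definition incident n (x : label n) (p : blabel n) := (x == p.1) || (x == p.2).

Definition arcs_at n (x : label n) : {set blabel n} :=
  [set p in arcs n | incident x p].

Definition arc_of n (x y : label n) : blabel n :=
  if oedge x y then (x, y) else (y, x).

Lemma incident_arc_of n (x y z : label n) :
  incident z (arc_of x y) = (z == x) || (z == y).
Proof. by rewrite /arc_of; case: ifP => _ //; rewrite /incident orbC. Qed.

Lemma arcs_atE n (x : label n) : arcs_at x = arc_of x @: [set y | cadj x y].
Proof.
apply/setP=> p; apply/idP/imsetP => [|[y]]; last first.
  rewrite inE => xy ->; rewrite inE incident_arc_of eqxx andbT inE /arc_of.
  by case: ifP xy => //; rewrite /cadj => ->.
case: p => [u v]; rewrite !inE /incident /= => /andP[uv /orP[]/eqP->].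
  by exists v; rewrite ?inE /cadj ?uv // /arc_of uv.
by exists u; rewrite ?inE /cadj ?uv ?orbT // /arc_of (negPf (oedge_asym uv)).
Qed.

Lemma card_arcs_at n (x : label n) : #|arcs_at x| = n.
Proof.
rewrite arcs_atE card_in_imset ?cadj_regular // => y z.
rewrite !inE => xy xz E; have := incident_arc_of x y y.
rewrite eqxx orbT E incident_arc_of => /orP[]/eqP // yx.
by rewrite yx cadj_irr in xy.
Qed.

Lemma arcs_atP n (x : label n) p : p \in arcs_at x ->
  exists2 y, cadj x y & p = arc_of x y.
Proof. by rewrite arcs_atE => /imsetP[y]; rewrite inE; exists y. Qed.

Lemma arc_ends n (p : blabel n) : p \in arcs n -> p.1 != p.2.
Proof. by rewrite inE; apply: contraTN => /eqP->; rewrite oedge_irr. Qed.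

Lemma arc_cadj n (p : blabel n) : p \in arcs n -> cadj p.1 p.2.
Proof. by rewrite inE /cadj => ->. Qed.

(** There are no parallel edges, nor an edge recorded in both directions. *)
Lemma incident2_eq n (p q : blabel n) : p \in arcs n -> q \in arcs n ->
  incident p.1 q -> incident p.2 q -> p = q.
Proof.
move=> pA qA; have neq := arc_ends pA; move: pA qA neq.
case: p q => [x y] [z t]; rewrite !inE /incident /= => xy zt neq.
case/orP=> /eqP Ex; case/orP=> /eqP Ey; subst x y => //.
- by rewrite eqxx in neq.
- by have := oedge_asym zt; rewrite xy.
- by rewrite eqxx in neq.
Qed.

Lemma share_entryP n (p q : blabel n) :
  reflect (exists2 x, incident x p & incident x q) (share_entry p q).
Proof.
apply: (iffP idP) => [/or4P[]/eqP E|[x /orP[]/eqP-> /orP[]/eqP E]].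
- by exists p.1; rewrite /incident -?E eqxx.
- by exists p.1; rewrite /incident -?E eqxx ?orbT.
- by exists p.2; rewrite /incident -?E eqxx ?orbT.
- by exists p.2; rewrite /incident -?E eqxx ?orbT.
all: by rewrite /share_entry E eqxx ?orbT.
Qed.

Lemma arcs_at_sharing n (p q : blabel n) :
  q \in arcs n -> share_entry p q = (q \in arcs_at p.1) || (q \in arcs_at p.2).
Proof.
by rewrite inE => qA; rewrite !inE qA /share_entry /incident -!orbA.
Qed.

Definition side n (p : blabel n) (x : label n) := arcs_at x :\ p.

(** A common end of [a] and [b] would be the third vertex of a triangle on [p]; an
end of [p] is excluded, as then [a] or [b] would have both ends of [p]. *)
Lemma sides_unshared n (p a b : blabel n) : p \in arcs n ->
  a \in side p p.1 -> b \in side p p.2 -> ~~ share_entry a b.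
Proof.
move=> pA /setD1P[ap aA] /setD1P[bp bA].
have [x px aE] := arcs_atP aA; have [y py bE] := arcs_atP bA.
have aA' : a \in arcs n by move: aA; rewrite inE => /andP[].
have bA' : b \in arcs n by move: bA; rewrite inE => /andP[].
apply/share_entryP=> -[z]; rewrite aE bE !incident_arc_of.
move=> /orP[]/eqP Ez /orP[]/eqP Ez'; subst z.
- by have := arc_ends pA; rewrite Ez' eqxx.
- case/negP: bp; apply/eqP/esym/incident2_eq;
    by rewrite // bE incident_arc_of ?Ez' eqxx ?orbT.
- case/negP: ap; apply/eqP/esym/incident2_eq;
    by rewrite // aE incident_arc_of ?Ez' eqxx ?orbT.
- rewrite -Ez' cadjC in py.
  by have := cadj_triangle_free px py; rewrite arc_cadj.
Qed.

Lemma card_sides n (p : blabel n) : p \in arcs n ->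
  #|side p p.1| = n.-1 /\ #|side p p.2| = n.-1.
Proof.
move=> pA; have h x : incident x p -> #|side p x| = n.-1.
  move=> xp; have := cardsD1 p (arcs_at x).
  by rewrite card_arcs_at inE pA xp /= add1n => /(congr1 predn) /= ->.
by rewrite !h // /incident eqxx ?orbT.
Qed.

Lemma card_covered_leq (T U : finType) (F : {set T}) (V : T -> {set U}) (A : {set U}) :
  (forall K, K \in F -> #|V K| <= 2) -> A \subset \bigcup_(K in F) V K ->
  #|A| <= #|[set K in F | V K :&: A != set0]|.*2.
Proof.
move=> V2 sA; set FA := [set K in F | _].
have sA' : A \subset \bigcup_(K in FA) V K.
  apply/subsetP=> a aA; have /bigcupP[K KF aK] := subsetP sA _ aA.
  apply/bigcupP; exists K => //; rewrite inE KF.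
  by apply/set0Pn; exists a; rewrite inE aK.
apply: leq_trans (subset_leq_card sA') _.
have le_bigcup : #|\bigcup_(K in FA) V K| <= \sum_(K in FA) #|V K|.
  elim/big_rec2: _ => [|K m W _ IH]; first by rewrite cards0.
  by rewrite cardsU; lia.
apply: leq_trans le_bigcup _; rewrite -muln2 -sum_nat_const.
by apply: leq_sum => K; rewrite inE => /andP[/V2].
Qed.

(** What the argument retains of a member of a substructure cut for [star 1]: its
vertices are one vertex of the line graph or two adjacent ones. *)
Definition line_clique n (S : {set blabel n}) :=
  [/\ S \subset arcs n, #|S| <= 2 & {in S &, forall p q, share_entry p q}].

(** No member meets both sides of [p], and each covers at most two of the [n.-1]
elements of a side. *)
Lemma isolation_cost n (F : {set graph (blabel n)}) (p : blabel n) :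
  (forall K, K \in F -> line_clique V(K)) -> p \in arcs n ->
  (forall q, q \in arcs n -> q != p -> share_entry p q ->
     q \in \bigcup_(K in F) V(K)) ->
  (uphalf n.-1).*2 <= #|F|.
Proof.
move=> cF pA nbrW; have V2 K : K \in F -> #|V(K)| <= 2 by case/cF.
have sub x : incident x p -> side p x \subset \bigcup_(K in F) V(K).
  move=> xp; apply/subsetP=> q /setD1P[qp]; rewrite inE => /andP[qA xq].
  by apply: nbrW => //; apply/share_entryP; exists x.
have [c1 c2] := card_sides pA.
have := card_covered_leq V2 (sub p.1 _); rewrite c1 /incident eqxx => /(_ isT).
have := card_covered_leq V2 (sub p.2 _); rewrite c2 /incident eqxx orbT => /(_ isT).
set F2 := [set K in F | _]; set F1 := [set K in F | _] => le2 le1.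
have disj : [disjoint F1 & F2].
  apply/pred0P=> K /=; apply/negP => /andP[]; rewrite !inE.
  case/andP=> KF /set0Pn[a /setIP[aK a1]] /andP[_ /set0Pn[b /setIP[bK b2]]].
  by have [_ _ /(_ a b aK bK)] := cF _ KF; rewrite (negPf (sides_unshared pA a1 b2)).
have : #|F1 :|: F2| <= #|F|.
  by apply: subset_leq_card; apply/subsetP=> K; rewrite !inE => /orP[]/andP[].
rewrite cardsU disjoint_setI0 // cards0; lia.
Qed.

(** * Lower bound *)

Lemma adj_B n p q : 1 < n ->
  adj (B n) p q = [&& p \in arcs n, q \in arcs n, p != q & share_entry p q].
Proof. by move=> n1; rewrite /adj E_B // mem_line_edges. Qed.

Lemma adj_del n W p q : 1 < n -> adj (del_vertices (B n) W) p q =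
  [&& p \in arcs n :\: W, q \in arcs n :\: W, p != q & share_entry p q].
Proof.
move=> n1; rewrite /adj inE -/(adj (B n) p q) adj_B // V_B // subUset !sub1set.
rewrite !in_setD; case: (p \in arcs n); case: (q \in arcs n); rewrite ?andbF //= !andbT.
by rewrite andbC -andbA.
Qed.

(** A common end of [p] and [q] puts one end of [q] in the pair; were the other
there too, [q] would be [p]. *)
Lemma boundary_pair n (p q : blabel n) : p \in arcs n -> q \in arcs n ->
  q != p -> share_entry p q -> q \in boundary [set p.1; p.2].
Proof.
move=> pA qA qp sh; have [x xp xq] := share_entryP _ _ sh.
move: (qA); rewrite !inE => -> /=; rewrite -/(incident q.1 p) -/(incident q.2 p).
have : ~~ (incident q.1 p && incident q.2 p).
  by apply: contra qp => /andP[i1 i2]; apply/eqP/incident2_eq.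
have : incident q.1 p || incident q.2 p.
  by case/orP: xq => /eqP<-; rewrite xp ?orbT.
by case: incident; case: incident.
Qed.

Lemma boundaryC n (X : {set label n}) : boundary (~: X) = boundary X.
Proof.
by apply/setP=> p; rewrite !inE; case: (p.1 \in X); case: (p.2 \in X).
Qed.

(** [X] is the set of ends of the edges reachable from [p] in what remains of the
line graph; a remaining edge with an end in [X] is itself reachable, so its
other end is in [X] as well. *)
Lemma disconnected_boundary n (W : {set blabel n}) : 1 < n ->
  disconnected (del_vertices (B n) W) ->
  exists p q (X : {set label n}),
    [/\ p \in arcs n, q \in arcs n, [set p.1; p.2] \subset X,
        [set q.1; q.2] \subset ~: X & boundary X \subset W].
Proof.
move=> n1 [p [q []]]; rewrite /= V_B // => pV qV.
set e := adj _ => ncon.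
have conV r : connect e p r -> r \in arcs n :\: W.
  case/connectP=> s; case: (lastP s) => [_ ->|s' r'] //.
  rewrite rcons_path last_rcons => /andP[_].
  by rewrite /e adj_del // => /and4P[_ rV _ _] ->.
pose X := [set x | [exists r, connect e p r && incident x r]].
have XP x r : r \in arcs n :\: W -> x \in X -> incident x r -> connect e p r.
  move=> rV; rewrite inE => /existsP[s /andP[ps xs]] xr.
  have [<- //|sr] := eqVneq s r.
  apply: connect_trans (ps) (connect1 _); rewrite /e adj_del // rV (conV _ ps) sr /=.
  by apply/share_entryP; exists x.
have inX x r : connect e p r -> incident x r -> x \in X.
  by move=> pr xr; rewrite inE; apply/existsP; exists r; rewrite pr.
exists p, q, X; split.
- by case/setDP: pV.
- by case/setDP: qV.
- by apply/subsetP=> x; rewrite !inE -/(incident x p) => xp;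
    apply/existsP; exists p; rewrite connect0.
- apply/subsetP=> x; rewrite [x \in [set _; _]]inE !in_set1 -/(incident x q) => xq.
  by rewrite inE; apply: contra ncon => xX; apply: XP xX xq.
apply/subsetP=> r; rewrite inE => /andP[rA bd].
apply: contraTT bd => rW.
have rV : r \in arcs n :\: W by rewrite !inE rW.
have [i1 i2] : incident r.1 r /\ incident r.2 r by rewrite /incident !eqxx orbT.
rewrite negbK; apply/eqP; apply/idP/idP => rX.
  exact: inX (XP _ _ rV rX i1) i2.
exact: inX (XP _ _ rV rX i2) i1.
Qed.

Lemma star1_edge (e : {set 'I_2}) i j :
  e \in E(star 1) -> i != j -> e = [set i; j].
Proof.
case/imsetP=> k _ ->; rewrite (ord1 k) => ij; apply/setP=> l; rewrite !inE.
by case: i j l ij => [[|[|]]// ?] [[|[|]]// ?] [[|[|]]// ?].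
Qed.

(** Two vertices of a connected subgraph of a single edge can only be joined by
that edge, and the isomorphism carries it to an edge of the line graph. *)
Lemma substructure_clique n (K : graph (blabel n)) (H : graph 'I_2) : 1 < n ->
  subgraph K (B n) -> subgraph H (star 1) -> connected H -> isomorphic H K ->
  line_clique V(K).
Proof.
move=> n1 [_ sV sE] [_ _ sH] [_ conH] [f injf EK]; split.
- by rewrite -V_B.
- rewrite EK /=; apply: leq_trans (leq_imset_card _ _) _.
  by apply: leq_trans (max_card _) _; rewrite card_ord.
move=> p q; rewrite {1 2}EK /= => /imsetP[i iH ->] /imsetP[j jH ->].
have [->|ij] := eqVneq i j; first by rewrite /share_entry eqxx.
have /connectP[[|k s] /=] := conH _ _ iH jH; first by move=> _ E; rewrite E eqxx in ij.
case/andP=> ik _ _; have ijH : [set i; j] \in E(H).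
  by rewrite -(star1_edge (subsetP sH _ ik) ij).
have : [set f i; f j] \in E(B n).
  by apply: (subsetP sE); rewrite EK /= -imset_set2; apply: imset_f.
by rewrite E_B // mem_line_edges => /and4P[].
Qed.

Lemma cut_lower_bound n (F : {set graph (blabel n)}) : 3 < n ->
  substructure_cut (B n) (star 1) F -> (uphalf n.-1).*2 <= #|F|.
Proof.
move=> n4 [[sub cut] str]; have n1 : 1 < n by lia.
have cF K : K \in F -> line_clique V(K).
  move=> KF; have [H [sH cH iH]] := str _ KF.
  by apply: substructure_clique iH => //; apply: sub.
move: cut; set W := \bigcup_(K in F) V(K) => -[dis|/eqP/cards1P[p]]; last first.
  rewrite /= V_B // => E.
  have pV : p \in arcs n :\: W by rewrite E set11.
  apply: (isolation_cost cF (p := p)); first by case/setDP: pV.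
  move=> q qA qp _; apply: contraNT qp => qW.
  by rewrite -in_set1 -E in_setD qW.
have [p [q [X [pA qA pX qX bW]]]] := disconnected_boundary n1 dis.
have c2 (r : blabel n) : r \in arcs n -> #|[set r.1; r.2]| = 2.
  by move=> rA; rewrite cards2 arc_ends.
have cX := subset_leq_card pX; have cXC := subset_leq_card qX; rewrite !c2 // in cX cXC.
have cC := cardsC X; rewrite card_tuple card_bool in cC.
have [leX|gtX] := leqP #|X| 2.
  have EX : [set p.1; p.2] = X by apply/eqP; rewrite eqEcard pX c2.
  apply: (isolation_cost cF pA) => r rA rp sh; apply: (subsetP bW).
  by rewrite -EX boundary_pair.
have [leXC|gtXC] := leqP #|~: X| 2.
  have EX : [set q.1; q.2] = ~: X by apply/eqP; rewrite eqEcard qX c2.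
  apply: (isolation_cost cF qA) => r rA rp sh; apply: (subsetP bW).
  by rewrite -boundaryC -EX boundary_pair.
have leW : #|W| <= #|F|.*2.
  have V2 K : K \in F -> #|V(K)| <= 2 by case/cF.
  apply: leq_trans (card_covered_leq V2 (subxx _)) _; rewrite leq_double.
  by apply: subset_leq_card; apply/subsetP=> K; rewrite inE => /andP[].
have := leq_trans (edge_isoperimetry X) (leq_trans (subset_leq_card bW) leW).
rewrite /isoperimetric_bound -cC; do !case: ifP => ?; lia.
Qed.

(** * A cut of minimum size *)

(** Pair the elements off two by two; with three left, use two overlapping pairs. *)
Lemma pair_cover (T : finType) (A : {set T}) : 1 < #|A| ->
  exists P : {set {set T}}, [/\ #|P| = uphalf #|A|, cover P = A &
    forall S, S \in P -> #|S| = 2].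
Proof.
have [m] := ubnP #|A|; elim: m A => // m IHm A ltAm A1.
have [a [b [aA bA ab]]] : exists a b, [/\ a \in A, b \in A & a != b].
  by case/card_gt1P: A1 => a [b [? ? ?]]; exists a, b.
have cA := cardsD1 a A; have cA' := cardsD1 b (A :\ a).
rewrite !inE aA bA eq_sym ab /= in cA cA'.
have AE : A = [set a; b] :|: (A :\ a :\ b).
  apply/setP=> x; rewrite !inE; case: eqVneq => [->|_] //=.
  by case: eqVneq => [->|_].
case E : #|A :\ a :\ b| => [|[|k]].
- exists [set [set a; b]]; split=> [||S].
  + by rewrite cards1; lia.
  + by rewrite /cover big_set1 [RHS]AE (cards0_eq E) setU0.
  + by move/set1P->; rewrite cards2 ab.
- have /cards1P[c cE] : #|A :\ a :\ b| == 1 by rewrite E.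
  have [bc ac] : b != c /\ a != c.
    have : c \in A :\ a :\ b by rewrite cE set11.
    by rewrite !inE ![c == _]eq_sym => /and3P[].
  have neq : [set a; b] != [set b; c].
    by apply/eqP=> /setP/(_ a); rewrite !inE eqxx (negPf ab) (negPf ac).
  exists [set [set a; b]; [set b; c]]; split=> [||S].
  + by rewrite cards2 neq; lia.
  + rewrite /cover bigcup_setU !big_set1 [RHS]AE cE.
    by apply/setP=> x; rewrite !inE; case: (x == a); case: (x == b).
  + by case/set2P=> ->; rewrite cards2 ?ab ?bc.
have [||P [cP PA P2]] := IHm (A :\ a :\ b); [lia | by rewrite E | ].
exists ([set a; b] |: P); split=> [||S].
+ rewrite cardsU1 cP; suff -> : [set a; b] \notin P by lia.
  apply/negP=> abP; have : a \in cover P.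
    by apply/bigcupP; exists [set a; b]; rewrite ?set21.
  by rewrite PA !inE eqxx andbF.
+ by rewrite /cover bigcup_setU big_set1 -/(cover P) PA.
by case/setU1P=> [->|/P2 //]; rewrite cards2 ab.
Qed.

Definition edge_graph (T : finType) (S : {set T}) : graph T := (S, [set S]).

Lemma edge_graph_iso (T : finType) (S : {set T}) : #|S| = 2 ->
  isomorphic (star 1) (edge_graph S).
Proof.
move=> S2; have /cards2P[a [b [ab ->]]] : #|S| == 2 by rewrite S2.
pose f (i : 'I_2) := if i == ord0 then a else b.
exists f.
  move=> [[|[|]]// ?] [[|[|]]// ?] _ _; rewrite /f /= => E; apply: val_inj => //=;
    by rewrite E eqxx in ab.
have fE : f @: [set ord0; lift ord0 ord0] = [set a; b] by rewrite imset_set2.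
rewrite /image_graph /edge_graph /=; congr pair.
  rewrite -fE; suff -> : [set: 'I_2] = [set ord0; lift ord0 ord0] by [].
  by apply/setP=> -[[|[|]] // ?]; rewrite !inE.
apply/setP=> e; rewrite inE; apply/eqP/imsetP => [->|[e' /imsetP[k _ ->] ->]].
  by exists [set ord0; lift ord0 ord0] => //; apply: imset_f.
by rewrite (ord1 k).
Qed.

Lemma star1_connected : connected (star 1).
Proof.
split; first by apply/set0Pn; exists ord0; rewrite inE.
move=> i j _ _; have [->|ij] := eqVneq i j; first exact: connect0.
apply: connect1; rewrite /adj.
have e0 : [set ord0; lift ord0 ord0] \in E(star 1) by apply: imset_f.
by rewrite -(star1_edge e0 ij).
Qed.

Lemma subgraph_star1 : subgraph (star 1) (star 1).
Proof.
split=> // e /imsetP[i _ ->]; split; first exact: subsetT.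
by rewrite cards2.
Qed.

Lemma structure_substructure (T : finType) (G : graph T) F :
  structure_cut G (star 1) F -> substructure_cut G (star 1) F.
Proof.
case=> cut iso; split=> // K KF; exists (star 1).
by split; [apply: subgraph_star1 | apply: star1_connected | apply: iso].
Qed.

(** Walk from [p] two steps further along the cube, never turning back: the second
step avoids both ends of [p], since there is no triangle. *)
Lemma far_arc n (p : blabel n) : 2 < n -> p \in arcs n ->
  exists q, [/\ q \in arcs n, q != p & ~~ share_entry p q].
Proof.
move=> n2 pA.
have other (x y : label n) : exists2 z, cadj x z & z != y.
  have : 0 < #|[set z | cadj x z] :\ y|.
    by have := cardsD1 y [set z | cadj x z]; rewrite cadj_regular; lia.
  by case/card_gt0P=> z; rewrite !inE => /andP[? ?]; exists z.
have [x p2x xp1] := other p.2 p.1; have [y xy yp2] := other x p.2.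
have p1y : y != p.1.
  apply: contraTneq (arc_cadj pA) => yE; rewrite yE in xy.
  by rewrite cadjC (cadj_triangle_free p2x xy).
have p2x' : x != p.2 by apply: contraTneq p2x => ->; rewrite cadj_irr.
have qA : arc_of x y \in arcs n.
  have : arc_of x y \in arcs_at x by rewrite arcs_atE imset_f ?inE.
  by rewrite inE => /andP[].
have nsh : ~~ share_entry p (arc_of x y).
  apply/share_entryP=> -[z zp]; rewrite incident_arc_of => /orP[]/eqP zE.
    by move: zp; rewrite zE /incident (negPf xp1) (negPf p2x').
  by move: zp; rewrite zE /incident (negPf p1y) (negPf yp2).
exists (arc_of x y); split=> //; apply: contraNneq nsh => ->.
by rewrite /share_entry eqxx.
Qed.

Lemma cut_upper_bound n : 2 < n ->
  exists2 F, structure_cut (B n) (star 1) F & #|F| = (uphalf n.-1).*2.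
Proof.
move=> n2; have n1 : 1 < n by lia.
have [p pA] : exists p, p \in arcs n.
  have /card_gt0P[p] : 0 < #|arcs_at ([tuple of nseq n false] : label n)|.
    by rewrite card_arcs_at; lia.
  by rewrite inE => /andP[]; exists p.
have [c1 c2] := card_sides pA.
have [|P1 [cP1 cov1 P12]] := @pair_cover _ (side p p.1); first by rewrite c1; lia.
have [|P2 [cP2 cov2 P22]] := @pair_cover _ (side p p.2); first by rewrite c2; lia.
have disj : [disjoint P1 & P2].
  apply/pred0P=> S /=; apply/negP => /andP[S1 S2].
  have /card_gt0P[a aS] : 0 < #|S| by rewrite P12.
  have a1 : a \in side p p.1 by rewrite -cov1; apply/bigcupP; exists S.
  have a2 : a \in side p p.2 by rewrite -cov2; apply/bigcupP; exists S.
  by have := sides_unshared pA a1 a2; rewrite /share_entry eqxx.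
have inj : injective (@edge_graph (blabel n)) by move=> S S' [].
exists (@edge_graph _ @: (P1 :|: P2)); last first.
  by rewrite card_imset // cardsU disjoint_setI0 // cards0 cP1 cP2 c1 c2 addnn subn0.
have WE : \bigcup_(K in @edge_graph _ @: (P1 :|: P2)) V(K) = side p p.1 :|: side p p.2.
  by rewrite big_imset /=; [rewrite bigcup_setU -cov1 -cov2 | move=> S S' _ _ /inj].
have clique S : S \in P1 :|: P2 -> exists2 x, incident x p & S \subset side p x.
  case/setUP=> SP; [exists p.1 | exists p.2]; rewrite /incident ?eqxx ?orbT //.
    by rewrite -cov1; apply: (bigcup_sup S).
  by rewrite -cov2; apply: (bigcup_sup S).
have card2 S : S \in P1 :|: P2 -> #|S| = 2 by case/setUP; [apply: P12 | apply: P22].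
split; last by move=> _ /imsetP[S SP ->]; apply/edge_graph_iso/card2.
split.
  move=> _ /imsetP[S SP ->]; have [x xp Sx] := clique _ SP.
  have sA : S \subset arcs n.
    by apply: subset_trans Sx _; apply/subsetP=> q; rewrite !inE => /and3P[].
  split; first by move=> e /set1P->; rewrite card2.
    by rewrite V_B.
  rewrite sub1set E_B //.
  have /cards2P[a [b [ab SE]]] : #|S| == 2 by rewrite card2.
  have [aS bS] : a \in S /\ b \in S by rewrite SE set21 set22.
  rewrite SE mem_line_edges !(subsetP sA) // ab /=.
  move: (subsetP Sx _ aS) (subsetP Sx _ bS); rewrite !inE.
  by move=> /and3P[_ _ xa] /and3P[_ _ xb]; apply/share_entryP; exists x.
rewrite WE; left; have [q [qA qp nsh]] := far_arc n2 pA.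
have qW : q \notin side p p.1 :|: side p p.2.
  apply: contra nsh; rewrite !inE => /orP[]/and3P[_ _ i]; apply/share_entryP.
    by exists p.1; rewrite /incident ?eqxx.
  by exists p.2; rewrite /incident ?eqxx ?orbT.
have pW : p \notin side p p.1 :|: side p p.2 by rewrite !inE eqxx.
exists p, q; split; rewrite /= ?V_B // ?in_setD ?pW ?qW //.
apply/connectP=> -[[|r s] /=]; first by move=> _ E; rewrite E eqxx in qp.
case/andP; rewrite adj_del // => /and4P[_ /setDP[rA rW] pr sh] _ _.
case/negP: rW; rewrite /side -setDUl in_setD1 eq_sym pr in_setU.
by rewrite -arcs_at_sharing.
Qed.

Lemma kappa_B n : 3 < n ->
  kappa (B n) (star 1) n./2.*2 /\ kappa_s (B n) (star 1) n./2.*2.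
Proof.
move=> n4; have [F cutF cF] := cut_upper_bound (ltnW n4).
have low := @cut_lower_bound n ^~ n4.
(* For positive [n], [uphalf n.-1] and [n./2] agree. *)
rewrite uphalfE prednK in cF low; [|by lia..].
split; split=> [|F' cut].
- by exists F.
- exact/low/structure_substructure.
- by exists F => //; apply: structure_substructure.
exact: low.
Qed.

Theorem theorem4p5 :
  (forall n : nat, 5 <= n -> odd n ->
     kappa (B n) (star 1) n.-1 /\ kappa_s (B n) (star 1) n.-1) /\
  (forall n : nat, 4 <= n -> ~~ odd n ->
     kappa (B n) (star 1) n /\ kappa_s (B n) (star 1) n).
Proof.
split=> n len oddn.
  have -> : n.-1 = n./2.*2 by lia.
  by apply: kappa_B; apply: ltnW.
have nE : n./2.*2 = n by lia.
by have := kappa_B len; rewrite nE.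
Qed.
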